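(* Let $F$ be a field of characteristic $0$ and let $L$ be a finite-dimensional $n$-ary algebra over $F$ such that $\mathrm{QDer}_{LL}(L)=\mathrm{End}(L)$. Then: 1) If $L$ is commutative, then either $L$ has zero product, or $L\cong L_\alpha$ for some $\alpha\in F$. Moreover, if the base field $F$ of $L$ is algebraically closed, then one can define a binary multiplication $\cdot$ on $L$ such that $(L,\cdot)\cong F$ and $[x_1,\ldots,x_n]=x_1\cdot\ldots\cdot x_n$ for $x_1,\ldots,x_n\in L$, where $[\cdot,\ldots,\cdot]$ is the multiplication in $L$. 2) If $L$ is anticommutative, then either $L$ has zero product, or $L$ is isomorphic to either $A_n$ or $L_B$ for a nondegenerate $(n+1)\times(n+1)$-matrix $B$. Moreover, in the last case, if $L$ is a Filippov algebra and the base field is algebraically closed, then $L\cong D_{n+1}$.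
   Context: An $n$-ary algebra over $F$ is a vector space $L$ with an $n$-linear map $[\cdot,\ldots,\cdot]:L^n\to L$. It is commutative if $[x_{\sigma(1)},\ldots,x_{\sigma(n)}]=[x_1,\ldots,x_n]$ for all $\sigma\in S_n$, and anticommutative if $[x_{\sigma(1)},\ldots,x_{\sigma(n)}]=\mathrm{sgn}(\sigma)[x_1,\ldots,x_n]$ for all $\sigma\in S_n$ ($\mathrm{sgn}(\sigma)=\pm1$ is the sign of $\sigma$). A Filippov ($n$-Lie) algebra is an anticommutative $n$-ary algebra with $[[x_1,\ldots,x_n],y_2,\ldots,y_n]=\sum_{i=1}^n[x_1,\ldots,[x_i,y_2,\ldots,y_n],\ldots,x_n]$. $\mathrm{End}(L)$ is the space of all linear maps $L\to L$. $\mathrm{QDer}_{LL}(L)$ (quasiderivations in the sense of Leger and Luks) is the set of $f\in\mathrm{End}(L)$ for which there is $d\in\mathrm{End}(L)$ with $d([a_1,\ldots,a_n])=\sum_{i=1}^n[a_1,\ldots,a_{i-1},f(a_i),a_{i+1},\ldots,a_n]$ for all $a_1,\ldots,a_n\in L$. $L_\alpha$ ($\alpha\in F$): the one-dimensional $n$-ary algebra $Fv$ with $[v,\ldots,v]=\alpha v$. $A_n$: the $n$-dimensional anticommutative $n$-ary algebra with basis $e_1,\ldots,e_n$ and $[e_1,\ldots,e_n]=e_1$. $L_B$, for an $(n+1)\times(n+1)$-matrix $B=(\beta_{ij})$ over $F$: the $(n+1)$-dimensional anticommutative $n$-ary algebra with basis $e_1,\ldots,e_{n+1}$ in which, setting $e^i=(-1)^{n+i+1}[e_1,\ldots,\hat{e_i},\ldots,e_{n+1}]$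 ($\hat{\ }$ denotes omission), one has $e^i=\beta_{1i}e_1+\cdots+\beta_{n+1,i}e_{n+1}$ for $i=1,\ldots,n+1$. $D_{n+1}$: the anticommutative $n$-ary algebra with basis $e_1,\ldots,e_{n+1}$ and $[e_1,\ldots,\hat{e_i},\ldots,e_{n+1}]=(-1)^{n+i+1}e_i$, i.e. $D_{n+1}=L_I$ with $I$ the identity matrix.
   Formalization: It is assumed that n ≥ 2 (for n = 1 the identity map on a 3-dimensional space is a counterexample), and the ''moreover'' of part 1 is stated only for L with nonzero product, since a zero product cannot equal x_1·…·x_n with (L,·) ≅ F. *)

(* Defs.v *)
From HB Require Import structures.
From mathcomp Require Import all_boot all_order all_fingroup all_algebra.
Set Implicit Arguments.
Unset Strict Implicit.
Unset Printing Implicit Defensive.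
Import GRing.Theory.
Local Open Scope ring_scope.

Definition subst_arg (n : nat) (T : Type) (x : {ffun 'I_n -> T})
    (i : 'I_n) (u : T) : {ffun 'I_n -> T} :=
  [ffun j => if j == i then u else x j].

Definition multilinear (F : fieldType) (n : nat) (V W : lmodType F)
    (f : {ffun 'I_n -> V} -> W) : Prop :=
  forall (x : {ffun 'I_n -> V}) (i : 'I_n) (a : F) (u v : V),
    f (subst_arg x i (a *: u + v)) =
    a *: f (subst_arg x i u) + f (subst_arg x i v).

(* Finite-dimensional n-ary algebras (a vectType is finite dimensional). *)
Record nalgebra (F : fieldType) (n : nat) := NAlgebra {
  carrier :> vectType F;
  bracket : {ffun 'I_n -> carrier} -> carrier;
  bracket_multilinear : multilinear bracket
}.

Section Notions.
Variables (F : fieldType) (n : nat).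
Implicit Types L M : nalgebra F n.

Definition commutative_nalg L : Prop :=
  forall (s : 'S_n) (x : {ffun 'I_n -> L}),
    bracket [ffun i => x (s i)] = bracket x.

Definition anticommutative_nalg L : Prop :=
  forall (s : 'S_n) (x : {ffun 'I_n -> L}),
    bracket [ffun i => x (s i)] = (-1) ^+ s *: bracket x.

(* The arguments y_2, ..., y_n are the entries of y other than the one at the
   first index i0; that entry is always overwritten. *)
Definition filippov L : Prop :=
  anticommutative_nalg L /\
  forall (i0 : 'I_n) (x y : {ffun 'I_n -> L}), i0 = 0%N :> nat ->
    bracket (subst_arg y i0 (bracket x)) =
    \sum_(i < n) bracket (subst_arg x i (bracket (subst_arg y i0 (x i)))).

Definition zero_product L : Prop :=
  forall x : {ffun 'I_n -> L}, bracket x = 0.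

Definition QDerLL L (f : 'End(L)) : Prop :=
  exists d : 'End(L), forall a : {ffun 'I_n -> L},
    d (bracket a) = \sum_(i < n) bracket (subst_arg a i (f (a i))).

Definition isomorphic L M : Prop :=
  exists f : 'Hom(L, M), bijective f /\
    forall x : {ffun 'I_n -> L}, f (bracket x) = bracket [ffun i => f (x i)].

End Notions.

(* (V, mul) is isomorphic, as an F-algebra, to F; this forces mul to be
   bilinear, associative and commutative. *)
Definition isomorphic_to_base (F : fieldType) (V : vectType F)
    (mul : V -> V -> V) : Prop :=
  exists phi : 'Hom(V, F^o), bijective phi /\
    forall x y : V, phi (mul x y) = (phi x : F) * (phi y : F).

(* The product ((x_1 . x_2) . ...) . x_n of a nonempty sequence; the value 0
   on the empty sequence is a junk value. *)
Definition iterated_mul (V : zmodType) (mul : V -> V -> V) (s : seq V) : V :=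
  if s is x :: s' then foldl mul x s' else 0.

Section Models.
Variables (F : fieldType) (n : nat).

Definition Lalpha_bracket (alpha : F) (x : {ffun 'I_n -> F^o}) : F^o :=
  alpha * \prod_(i < n) (x i : F).

Lemma Lalpha_multilinear (alpha : F) : multilinear (Lalpha_bracket alpha).
Proof.
move=> x i a u v.
have E w : Lalpha_bracket alpha (subst_arg x i w) =
    alpha * ((w : F) * \prod_(j < n | j != i) (x j : F)).
  rewrite /Lalpha_bracket (bigD1 i) //= ffunE eqxx; congr (_ * (_ * _)).
  by apply: eq_bigr => j /negbTE ji; rewrite ffunE ji.
rewrite !E /GRing.scale /= mulrDl mulrDr; congr (_ + _).
by rewrite -mulrA mulrCA.
Qed.

Definition Lalpha (alpha : F) : nalgebra F n :=
  NAlgebra (Lalpha_multilinear alpha).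

(* The product of L_alpha on its basis vector v = 1. *)
Lemma LalphaE (alpha : F) :
  @bracket F n (Lalpha alpha) [ffun=> 1 : F^o] = alpha *: (1 : F^o).
Proof.
by rewrite /= /Lalpha_bracket big1 // => i _; rewrite ffunE.
Qed.

Definition args_mx (m : nat) (x : {ffun 'I_n -> 'rV[F]_m}) : 'M[F]_(n, m) :=
  \matrix_(i < n, j < m) x i 0 j.

Lemma det_args_multilinear (m : nat) (g : 'I_n -> 'I_m)
    (x : {ffun 'I_n -> 'rV[F]_m}) (i : 'I_n) (a : F) (u v : 'rV[F]_m) :
  \det (colsub g (args_mx (subst_arg x i (a *: u + v)))) =
  a * \det (colsub g (args_mx (subst_arg x i u)))
  + \det (colsub g (args_mx (subst_arg x i v))).
Proof.
rewrite -[\det (colsub g (args_mx (subst_arg x i v)))]mul1r.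
apply: (@determinant_multilinear _ _ _ _ _ i).
- by apply/rowP=> j; rewrite !mxE !ffunE eqxx !mxE mul1r.
- by apply/matrixP=> k j; rewrite !mxE !ffunE eq_sym (negbTE (neq_lift _ _)).
- by apply/matrixP=> k j; rewrite !mxE !ffunE eq_sym (negbTE (neq_lift _ _)).
Qed.

Lemma det_args_perm (m : nat) (g : 'I_n -> 'I_m)
    (x : {ffun 'I_n -> 'rV[F]_m}) (s : 'S_n) :
  \det (colsub g (args_mx [ffun i => x (s i)])) =
  (-1) ^+ s * \det (colsub g (args_mx x)).
Proof.
rewrite -det_perm -det_mulmx -row_permE; congr (\det _).
by apply/matrixP=> k j; rewrite !mxE !ffunE.
Qed.

(* The anticommutative bracket on F^n with [e_1, ..., e_n] = e_1 is
   [x_1, ..., x_n] = det(x_1, ..., x_n) e_1. *)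
Definition first_vec : 'rV[F]_n := \row_(j < n) (j == 0%N :> nat)%:R.

Definition A_bracket (x : {ffun 'I_n -> 'rV[F]_n}) : 'rV[F]_n :=
  \det (args_mx x) *: first_vec.

Lemma colsub_idE (m : nat) (A : 'M[F]_(n, m)) : colsub (fun j => j) A = A.
Proof. by apply/matrixP=> i j; rewrite mxE. Qed.

Lemma A_multilinear : multilinear A_bracket.
Proof.
move=> x i a u v; rewrite /A_bracket scalerA -scalerDl.
by rewrite -(colsub_idE (args_mx _)) det_args_multilinear !colsub_idE.
Qed.

Definition A_nalg : nalgebra F n := NAlgebra A_multilinear.

Lemma A_anticommutative : anticommutative_nalg A_nalg.
Proof.
move=> s x; rewrite /= /A_bracket scalerA.
by rewrite -(colsub_idE (args_mx _)) det_args_perm !colsub_idE.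
Qed.

Lemma A_basisE :
  @bracket F n A_nalg [ffun i : 'I_n => delta_mx 0 i : 'rV[F]_n] = first_vec.
Proof.
rewrite /= /A_bracket (_ : args_mx _ = 1%:M) ?det1 ?scale1r //.
by apply/matrixP=> i j; rewrite !mxE ffunE !mxE eqxx eq_sym.
Qed.

(* The vector e^i of L_B, i.e. the i-th column of B.  Ordinals start at 0, so
   the 1-based index of i : 'I_n.+1 is i.+1. *)
Definition LB_vec (B : 'M[F]_n.+1) (i : 'I_n.+1) : 'rV[F]_n.+1 :=
  \sum_(j < n.+1) B j i *: delta_mx 0 j.

(* [x_1, ..., x_n] expands as the sum over i of the i-th maximal minor of the
   matrix with rows x_k times [e_1, ..., e_i omitted, ..., e_(n+1)]. *)
Definition LB_bracket (B : 'M[F]_n.+1) (x : {ffun 'I_n -> 'rV[F]_n.+1}) :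
    'rV[F]_n.+1 :=
  \sum_(i < n.+1)
    \det (col' i (args_mx x)) *: ((-1) ^+ (n + i.+1 + 1) *: LB_vec B i).

Lemma col'_colsub (i : 'I_n.+1) (A : 'M[F]_(n, n.+1)) :
  col' i A = colsub (lift i) A.
Proof. by apply/matrixP=> k j; rewrite !mxE. Qed.

Lemma LB_multilinear (B : 'M[F]_n.+1) : multilinear (LB_bracket B).
Proof.
move=> x k a u v; rewrite /LB_bracket scaler_sumr -big_split /=.
apply: eq_bigr => i _.
by rewrite !col'_colsub det_args_multilinear scalerDl -scalerA.
Qed.

Definition LB (B : 'M[F]_n.+1) : nalgebra F n := NAlgebra (LB_multilinear B).

Lemma LB_anticommutative (B : 'M[F]_n.+1) : anticommutative_nalg (LB B).
Proof.
move=> s x; rewrite /= /LB_bracket scaler_sumr; apply: eq_bigr => i _.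
by rewrite !col'_colsub det_args_perm -scalerA.
Qed.

Lemma LB_basisE (B : 'M[F]_n.+1) (i : 'I_n.+1) :
  (-1) ^+ (n + i.+1 + 1) *:
    @bracket F n (LB B) [ffun k : 'I_n => delta_mx 0 (lift i k) : 'rV[F]_n.+1]
  = \sum_(j < n.+1) B j i *: delta_mx 0 j.
Proof.
rewrite /= /LB_bracket (bigD1 i) //= big1 => [|j ji].
  rewrite (_ : col' i _ = 1%:M).
    by rewrite det1 scale1r addr0 scalerA -expr2 sqrr_sign scale1r.
  apply/matrixP=> k l; rewrite !mxE ffunE !mxE eqxx /=.
  by rewrite (inj_eq lift_inj) eq_sym.
case: (unliftP i j) ji => [k -> _|->]; last by rewrite eqxx.
rewrite (expand_det_row _ k) big1 ?scale0r // => l _.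
by rewrite !mxE ffunE !mxE eqxx eq_sym (negbTE (neq_lift _ _)) mul0r.
Qed.

Definition D_nalg : nalgebra F n := LB 1%:M.

Lemma D_basisE (i : 'I_n.+1) :
  @bracket F n D_nalg [ffun k : 'I_n => delta_mx 0 (lift i k) : 'rV[F]_n.+1]
  = (-1) ^+ (n + i.+1 + 1) *: delta_mx 0 i.
Proof.
have := LB_basisE 1%:M i; rewrite (bigD1 i) //= big1 => [|j /negbTE ji].
  rewrite mxE eqxx scale1r addr0 => <-.
  by rewrite scalerA -expr2 sqrr_sign scale1r.
by rewrite mxE ji scale0r.
Qed.

End Models.

(* Main.v *)
From HB Require Import structures.
Require Import Defs.
From mathcomp Require Import all_boot all_order all_fingroup all_algebra.
From mathcomp Require Import zify.
Set Implicit Arguments.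
Unset Strict Implicit.
Unset Printing Implicit Defensive.
Import GRing.Theory.
Local Open Scope ring_scope.

(** Every f : End(L) acts as a derivation on the arguments of the bracket, and
    the hypothesis says that this action descends along the bracket to some
    d_f : End(L). Hence the kernel of the bracket, seen on the symmetric or
    exterior power, is gl(L)-stable. In characteristic 0 these powers are
    irreducible, so the bracket is zero or injective on them, and comparing
    dimensions leaves dim L = 1 in the commutative case, dim L = n or n + 1 in
    the anticommutative one.

    Both halves of this are proved by hand on the monomials, the brackets of
    elements of a basis e. Irreducibility is [monomial_eq0]: if one monomial
    vanishes, then rank-one maps f, which replace one basis vector by an
    arbitrary vector, spread this vanishing to all arguments. For injectivity,
    the maps d_f with f the projection on a basis vector have all monomials as
    eigenvectors, the eigenvalues counting the occurrences of that basis vector;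
    hence nonzero monomials of pairwise different weights are linearly
    independent ([monomials_free]).

    In the commutative case with m = dim L >= 2, the powers of the m basis vectors
    and one mixed monomial would be m + 1 independent vectors, so the product is
    zero. In the anticommutative case there are binomial(m, n) independent
    monomials, hence binomial(m, n) <= m and m is n or n + 1. If m = n, the
    product is a determinant times a fixed nonzero vector, which a change of basis
    of determinant 1 turns into the first basis vector. If m = n + 1, the n + 1
    monomials are independent, so that the matrix B of L in this basis is
    invertible.

    For the last assertion, write the product of L_B as
    [x_1, ..., x_n] = cross x *m B^T, where cross is the generalised vector
    product, determined by cross x . z = det (x_1, ..., x_n, z). A map
    v |-> [v, y_2, ..., y_n] has the matrix K *m B^T with K skew, and the
    Filippov identity says that it is a derivation, which amounts to
    (B^T - B) *m K = tr (K *m B^T). As n >= 2, K kills y_2 and the trace is 0;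
    since the y are arbitrary, B is symmetric ([filippov_LB_symmetric]). Over an
    algebraically closed field T *m B *m T^T = 1 for some T, and a suitable
    multiple M of T^T satisfies M^T *m B^T *m M = det M, which is the condition for
    x |-> x *m M to be an isomorphism from L_B onto D_(n+1). *)

(** * Multilinear maps *)

Section Multilinear.
Variables (F : fieldType) (n : nat).

Lemma subst_arg_id (T : Type) (x : {ffun 'I_n -> T}) i :
  subst_arg x i (x i) = x.
Proof. by apply/ffunP=> j; rewrite ffunE; case: eqP => [->|]. Qed.

Lemma subst_arg_comp (T U : Type) (h : T -> U) (x : {ffun 'I_n -> T}) i u :
  [ffun j => h (subst_arg x i u j)] = subst_arg [ffun j => h (x j)] i (h u).
Proof. by apply/ffunP=> j; rewrite !ffunE; case: eqP. Qed.

Variables (V W : lmodType F).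
Implicit Types (f : {ffun 'I_n -> V} -> W) (x : {ffun 'I_n -> V}).

Lemma multilinear0 f x i : multilinear f -> f (subst_arg x i 0) = 0.
Proof.
by move=> fL; have := fL x i (-1) 0 0; rewrite scaler0 addr0 scaleN1r addNr.
Qed.

Lemma multilinearZ f x i a u : multilinear f ->
  f (subst_arg x i (a *: u)) = a *: f (subst_arg x i u).
Proof. by move=> fL; rewrite -[a *: u]addr0 fL multilinear0 ?addr0. Qed.

Lemma multilinear_sum f x i (I : finType) (a : I -> F) (u : I -> V) :
  multilinear f ->
  f (subst_arg x i (\sum_j a j *: u j)) =
  \sum_j a j *: f (subst_arg x i (u j)).
Proof.
move=> fL; elim/big_rec2: _ => [|j w v _ <-]; first exact: multilinear0.
exact: fL.
Qed.

End Multilinear.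

Section Rank1.
Variables (F : fieldType) (V : vectType F) (m : nat) (e : m.-tuple V).

Definition dyad (p : 'I_m) (z v : V) : V := coord e p v *: z.

Fact dyad_is_linear p z : linear (dyad p z).
Proof. by move=> a u v; rewrite /dyad linearP scalerDl scalerA. Qed.

HB.instance Definition _ p z :=
  GRing.isLinear.Build F V V *:%R (dyad p z) (dyad_is_linear p z).

Lemma coord_basis_full v : basis_of fullv e ->
  v = \sum_i coord e i v *: e`_i.
Proof. by move=> be; apply: coord_basis (memvf v). Qed.

Lemma coord_basisE (i j : 'I_m) : basis_of fullv e -> coord e i e`_j = (i == j)%:R.
Proof. by move=> be; rewrite coord_free ?(basis_free be) 1?eq_sym. Qed.

End Rank1.

(** The positions not yet known to hold a basis vector are expanded one at a
    time; A is the set of these positions. *)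
Lemma multilinear_ext (F : fieldType) (n m : nat) (V : vectType F)
    (W : lmodType F) (e : m.-tuple V) (f h : {ffun 'I_n -> V} -> W) :
  basis_of fullv e -> multilinear f -> multilinear h ->
  (forall g : 'I_n -> 'I_m,
     f [ffun i => e`_(g i)] = h [ffun i => e`_(g i)]) ->
  f =1 h.
Proof.
move=> be fL hL fh.
suff agree (A : {set 'I_n}) (x : {ffun 'I_n -> V}) :
    (forall i, i \notin A -> exists j : 'I_m, x i = e`_j) -> f x = h x.
  by move=> x; apply: (agree [set: 'I_n]) => i; rewrite inE.
have [k] := ubnP #|A|; elim: k A x => // k IHk A x; rewrite ltnS => Ak xe.
have [A0 | [p Ap]] := set_0Vmem A.
  have /fin_all_exists[g xg]: forall i, exists j : 'I_m, x i = e`_j.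
    by move=> i; apply: xe; rewrite A0 inE.
  by rewrite (_ : x = [ffun i => e`_(g i)]) //; apply/ffunP=> i; rewrite ffunE.
rewrite -(subst_arg_id x p) (coord_basis_full (x p) be) !multilinear_sum //.
apply: eq_bigr => j _; congr (_ *: _); apply: (IHk (A :\ p)) => [|i].
  by rewrite (cardsD1 p) Ap in Ak.
rewrite !inE negb_and negbK ffunE; case: eqP => [_ _ | _ /xe //].
by exists j.
Qed.

(** * Monomials and their weights *)

(** The usual argument for eigenvectors with distinct eigenvalues, except that
    the operator may depend on the pair to be separated: from a nontrivial
    relation containing v k and v l, applying d - w l, where d separates k from
    l, gives a shorter relation that still contains v k. *)
Lemma joint_eigenvectors_free (F : fieldType) (V : vectType F) (K : finType)
    (v : K -> V) :
  (forall k, v k != 0) ->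
  (forall k l, k != l -> exists (d : 'End(V)) (w : K -> F),
     w k != w l /\ forall i, d (v i) = w i *: v i) ->
  forall a : K -> F, \sum_k a k *: v k = 0 -> forall k, a k = 0.
Proof.
move=> v_neq0 sep a.
have [s] := ubnP #|[pred k | a k != 0]|; elim: s a => // s IHs a.
rewrite ltnS => les sum0 k; apply: contraTeq isT => ak.
have [l /andP[lk al] | lone] := pickP [pred l | (l != k) && (a l != 0)]; last first.
  move: sum0; rewrite (bigD1 k) //= big1 ?addr0 => [/eqP | l lk].
    by rewrite scaler_eq0 (negbTE ak) (negbTE (v_neq0 k)).
  by have := lone l; rewrite /= lk => /negbFE/eqP ->; rewrite scale0r.
have kl: k != l by rewrite eq_sym.
have [d [w [wkl dv]]] := sep k l kl.
pose b i := a i * (w i - w l).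
suff bk: b k = 0.
  by move/eqP: bk; rewrite mulf_eq0 (negbTE ak) subr_eq0 (negbTE wkl).
apply: (IHs b).
  apply: leq_trans les; apply/proper_card/properP; split.
    by apply/subsetP=> i; rewrite !inE /b mulf_eq0 negb_or => /andP[].
  by exists l; rewrite !inE // /b subrr mulr0 eqxx.
have dsum0: \sum_i (a i * w i) *: v i = 0.
  rewrite -[RHS](linear0 d) -[in RHS]sum0 linear_sum; apply: eq_bigr => i _.
  by rewrite linearZ /= dv scalerA.
have : \sum_i (a i * w i) *: v i - w l *: (\sum_i a i *: v i) = 0.
  by rewrite dsum0 sum0 scaler0 subr0.
rewrite scaler_sumr -sumrB => {2}<-; apply: eq_bigr => i _.
by rewrite scalerA -scalerBl /b mulrBr [w l * _]mulrC.
Qed.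

Lemma card_free_family (F : fieldType) (V : vectType F) (K : finType)
    (v : K -> V) :
  (forall a : K -> F, \sum_k a k *: v k = 0 -> forall k, a k = 0) ->
  (#|K| <= \dim {:V})%N.
Proof.
move=> vfree; pose X := [tuple v (enum_val i) | i < #|K|].
have: free X.
  apply/freeP=> a sum0 i; have := vfree (fun k => a (enum_rank k)) _ (enum_val i).
  rewrite enum_valK; apply.
  rewrite -[RHS]sum0 (reindex _ (onW_bij _ (enum_val_bij K))) /=.
  by apply: eq_bigr => j _; rewrite enum_valK nth_mktuple.
by rewrite /free size_tuple => /eqP <-; apply/dimvS/subvf.
Qed.

Lemma natr_inj (F : fieldType) :
  [pchar F] =i pred0 -> injective (fun k : nat => k%:R : F).
Proof.
move=> /pcharf0P F0 a b; wlog le_ab: a b / (a <= b)%N.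
  by move=> W; case/orP: (leq_total a b) => le E; [|symmetry]; apply: W.
move/eqP; rewrite eq_sym -subr_eq0 -natrB // F0 subn_eq0 => le_ba.
by apply/eqP; rewrite eqn_leq le_ab.
Qed.

Section QDer.
Variables (F : fieldType) (n m : nat) (L : nalgebra F n) (e : m.-tuple L).
Hypothesis charF0 : [pchar F] =i pred0.
Hypothesis qder_full : forall f : 'End(L), QDerLL f.
Hypothesis be : basis_of fullv e.

Definition monomial (c : 'I_n -> 'I_m) : L := bracket [ffun i => e`_(c i)].

Definition weight (c : 'I_n -> 'I_m) (j : 'I_m) : nat := #|[pred i | c i == j]|.

(** The rank-one maps [dyad e p z] suffice for the whole proof. *)
Lemma qder_dyad p z : exists d : 'End(L), forall a : {ffun 'I_n -> L},
  d (bracket a) = \sum_i coord e p (a i) *: bracket (subst_arg a i z).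
Proof.
have [d dE] := qder_full (linfun (dyad e p z)); exists d => a; rewrite dE.
by apply: eq_bigr => i _; rewrite lfunE multilinearZ //; apply: bracket_multilinear.
Qed.

(** The projection on e_j, acting as a derivation, multiplies a monomial by the
    number of its factors equal to e_j. *)
Lemma monomial_eigenvector j : exists d : 'End(L), forall c,
  d (monomial c) = (weight c j)%:R *: monomial c.
Proof.
have [d dE] := qder_dyad j e`_j; exists d => c; rewrite dE /weight -sum1_card.
rewrite natr_sum scaler_suml [RHS]big_mkcond /=; apply: eq_bigr => i _.
rewrite ffunE coord_basisE // inE /= eq_sym.
case: eqP => [cij|_]; last by rewrite scale0r.
by rewrite -cij -[e`_(c i)](ffunE (fun i => e`_(c i))) subst_arg_id.
Qed.

Lemma monomials_free (K : finType) (c : K -> 'I_n -> 'I_m) :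
  (forall k, monomial (c k) != 0) ->
  (forall k l, k != l -> exists j, weight (c k) j != weight (c l) j) ->
  forall a : K -> F, \sum_k a k *: monomial (c k) = 0 -> forall k, a k = 0.
Proof.
move=> c_neq0 sep; apply: joint_eigenvectors_free => // k l /sep[j wj].
have [d dE] := monomial_eigenvector j.
exists d, (fun k => (weight (c k) j)%:R); split=> //.
by apply: contra wj => /eqP/(natr_inj charF0)->.
Qed.

(** Irreducibility of the symmetric and exterior powers, in both cases at once:
    the hypothesis on c holds for every c if L is commutative, and trivially for
    c injective.

    By induction on A, bracket y = 0 when y agrees with e o c outside A. For
    p in A, replacing y p by e_(c p) gives y' whose bracket vanishes by
    induction; apply to y' the map e_(c p) |-> y p of rank one. The positions
    inside A - p only give brackets that vanish by induction, and those
    outside it with c i = c p give bracket y each, up to exchanging i and p.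
    Hence a positive integer multiple of bracket y is zero. *)
Lemma monomial_eq0 (c : 'I_n -> 'I_m) :
  (forall i p (x : {ffun 'I_n -> L}), c i = c p ->
     bracket [ffun k => x (tperm i p k)] = bracket x) ->
  monomial c = 0 -> zero_product L.
Proof.
move=> sym c0.
suff vanish (A : {set 'I_n}) (y : {ffun 'I_n -> L}) :
    (forall i, i \notin A -> y i = e`_(c i)) -> bracket y = 0.
  by move=> y; apply: (vanish [set: 'I_n]) => i; rewrite inE.
have [k] := ubnP #|A|; elim: k A y => // k IHk A y; rewrite ltnS => Ak yA.
have [A0 | [p Ap]] := set_0Vmem A.
  rewrite (_ : y = [ffun i => e`_(c i)]) //; apply/ffunP=> i.
  by rewrite ffunE yA // A0 inE.
have lt_k: (#|A :\ p| < k)%N by rewrite (cardsD1 p) Ap in Ak.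
pose y' := subst_arg y p e`_(c p).
have y'A i : i \notin A :\ p -> y' i = e`_(c i).
  by rewrite !inE negb_and negbK ffunE; case: eqP => [-> //|_ /yA].
have [d dE] := qder_dyad (c p) (y p).
have := dE y'; rewrite (IHk _ _ lt_k y'A) linear0.
(* The terms with c i <> c p vanish with the coefficient of e_(c p) in y' i. *)
have termE i : coord e (c p) (y' i) *: bracket (subst_arg y' i (y p)) =
    ((i \notin A :\ p) && (c i == c p))%:R *: bracket y.
  have [iA | iA] := boolP (i \in A :\ p).
    rewrite (IHk _ (subst_arg y' i (y p)) lt_k) ?scaler0 ?scale0r // => l lA.
    by rewrite ffunE; case: eqP lA => [-> |_ /y'A //]; rewrite iA.
  rewrite y'A // coord_basisE // eq_sym; case: eqP => [cip|_]; last by rewrite !scale0r.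
  congr (_ *: _); rewrite -[RHS](sym i p) //; congr bracket; apply/ffunP=> l.
  rewrite !ffunE; case: tpermP => [->|->|/eqP/negbTE li /eqP/negbTE lp].
  - by rewrite eqxx.
  - rewrite eqxx; case: eqP => [-> //|/eqP pi].
    by rewrite yA ?cip //; move: iA; rewrite !inE eq_sym pi.
  - by rewrite li lp.
rewrite (eq_bigr _ (fun i _ => termE i)) -scaler_suml -natr_sum => /esym/eqP.
rewrite scaler_eq0 (pcharf0P F).1 // => /orP[|/eqP //].
by rewrite sum_nat_eq0 => /forallP/(_ p); rewrite !inE !eqxx.
Qed.

End QDer.

(** * Isomorphisms tested on a basis *)

Section Morphisms.
Variables (F : fieldType) (n : nat).
Implicit Types L M : nalgebra F n.

Definition morph_at L M (phi : 'Hom(L, M)) (x : {ffun 'I_n -> L}) : Prop :=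
  phi (bracket x) = bracket [ffun i => phi (x i)].

Lemma isomorphic_on_basis L M (phi : 'Hom(L, M)) m (e : m.-tuple L) :
  basis_of fullv e -> bijective phi ->
  (forall g : 'I_n -> 'I_m, morph_at phi [ffun i => e`_(g i)]) ->
  isomorphic L M.
Proof.
move=> be phi_bij phi_e; exists phi; split=> // x.
pose f (y : {ffun 'I_n -> L}) := phi (bracket y).
pose h (y : {ffun 'I_n -> L}) := bracket [ffun i => phi (y i)].
apply: (@multilinear_ext _ _ _ _ _ e f h) => // {x} x i a u v; rewrite /f /h.
  by rewrite bracket_multilinear linearP.
by rewrite !subst_arg_comp linearP bracket_multilinear.
Qed.

Lemma anticommutative_repeat L (x : {ffun 'I_n -> L}) i j :
  [pchar F] =i pred0 -> anticommutative_nalg L ->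
  i != j -> x i = x j -> bracket x = 0.
Proof.
move=> /pcharf0P F0 anti ij xij; have := anti (tperm i j) x.
rewrite odd_tperm ij expr1 scaleN1r (_ : [ffun k => _] = x); last first.
  by apply/ffunP=> k; rewrite ffunE; case: tpermP => // ->.
move/eqP; rewrite -addr_eq0 -mulr2n -scaler_nat scaler_eq0 F0 /=.
by move/eqP.
Qed.

(** Injective families of basis vectors suffice because repeated arguments give
    0 on both sides, and one ordering of each family because reordering multiplies
    both sides by the same sign. *)
Lemma isomorphic_on_basis_anti L M (phi : 'Hom(L, M)) m (e : m.-tuple L) :
  [pchar F] =i pred0 -> anticommutative_nalg L -> anticommutative_nalg M ->
  basis_of fullv e -> bijective phi ->
  (forall g : 'I_n -> 'I_m, injective g ->
     exists s : 'S_n, morph_at phi [ffun i => e`_(g (s i))]) ->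
  isomorphic L M.
Proof.
move=> F0 antiL antiM be phi_bij phi_e; apply: (isomorphic_on_basis be phi_bij).
move=> g.
have [/injectiveP/phi_e[s] | /injectivePn[i [j ij gij]]] := boolP (injectiveb g).
  rewrite /morph_at; set x := [ffun i => e`_(g i)].
  rewrite (_ : [ffun i => _] = [ffun i => x (s i)]); last first.
    by apply/ffunP=> i; rewrite !ffunE.
  rewrite antiL linearZ /=.
  rewrite (_ : [ffun i => _] = [ffun i => [ffun j => phi (x j)] (s i)]); last first.
    by apply/ffunP=> i; rewrite !ffunE.
  rewrite antiM => /(congr1 (fun v => (-1) ^+ s *: v)).
  by rewrite !scalerA -expr2 sqrr_sign !scale1r.
rewrite /morph_at !(anticommutative_repeat F0 _ ij) ?linear0 // !ffunE gij //.
Qed.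

End Morphisms.

(** * The commutative case *)

Section Commutative.
Variables (F : fieldType) (n : nat) (L : nalgebra F n).
Hypothesis charF0 : [pchar F] =i pred0.
Hypothesis n_ge2 : (2 <= n)%N.

Lemma dim0_zero_product (e : 0.-tuple L) : basis_of fullv e -> zero_product L.
Proof.
move=> be x; pose i0 : 'I_n := Ordinal (ltnW n_ge2).
rewrite -(subst_arg_id x i0) (coord_basis_full (x i0) be) big_ord0.
by apply: multilinear0; apply: bracket_multilinear.
Qed.

Hypothesis qder_full : forall f : 'End(L), QDerLL f.

(** The weights of the n-th powers of the basis vectors and of the mixed product
    of one e_1 and n - 1 copies of e_0 are distinct, since 1 is neither 0
    nor n. *)
Lemma commutative_dim_ge2 m (e : m.-tuple L) :
  basis_of fullv e -> commutative_nalg L -> (2 <= m)%N -> zero_product L.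
Proof.
move=> be comm m_ge2; pose i0 : 'I_n := Ordinal (ltnW n_ge2).
pose j0 : 'I_m := Ordinal (ltnW m_ge2); pose j1 : 'I_m := Ordinal m_ge2.
pose c (k : option 'I_m) (i : 'I_n) : 'I_m :=
  if k is Some j then j else if i == i0 then j1 else j0.
have [k /eqP ck0 | c_neq0] := pickP (fun k => monomial e (c k) == 0).
  by apply: (monomial_eq0 charF0 qder_full be _ ck0) => i p x _; apply: comm.
have wS j l : weight (c (Some j)) l = if j == l then n else 0%N.
  rewrite /weight; case: eqP => jl; last by apply: eq_card0 => i; rewrite inE.
  by rewrite -[RHS]card_ord; apply: eq_card => i; rewrite !inE.
have wN : weight (c None) j1 = 1%N.
  by rewrite /weight -(card1 i0); apply: eq_card => i; rewrite !inE /c; case: (i == i0).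
have wSN j : weight (c (Some j)) j1 != weight (c None) j1.
  by rewrite wS wN; case: (j == j1) => //; rewrite gtn_eqF.
suff: (#|{: option 'I_m}| <= \dim {:L})%N.
  by rewrite card_option card_ord (size_basis be) ltnn.
apply: card_free_family; apply: (monomials_free charF0 qder_full be (c := c)).
  by move=> k; rewrite c_neq0.
case=> [j|] [l|] kl.
- have lj : (l == j) = false by apply: contraNF kl => /eqP ->.
  by exists j; rewrite !wS eqxx lj gtn_eqF // ltnW.
- by exists j1.
- by exists j1; rewrite eq_sym.
- by rewrite eqxx in kl.
Qed.

Lemma dim1_isomorphic (e : 1.-tuple L) :
  basis_of fullv e -> exists alpha : F, isomorphic L (Lalpha n alpha).
Proof.
move=> be; pose alpha := coord e 0 (monomial e (fun=> 0)).
exists alpha; pose phi : 'Hom(L, Lalpha n alpha) := linfun (coord e 0 : L -> F^o).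
have phiE v : phi v = coord e 0 v by rewrite lfunE.
apply: (isomorphic_on_basis (phi := phi) be) => [|g].
  exists (fun a : F => a *: e`_0) => [v | a]; rewrite phiE.
    by rewrite [RHS](coord_basis_full v be) big_ord1.
  by rewrite linearZ /= (coord_basisE 0 0 be) mulr1.
rewrite /morph_at phiE /= /Lalpha_bracket big1 ?mulr1 => [|i _].
  by congr (coord e 0 (bracket _)); apply/ffunP=> i; rewrite !ffunE (ord1 (g i)).
by rewrite !ffunE phiE (ord1 (g i)) (coord_basisE 0 0 be).
Qed.

End Commutative.

Lemma closed_field_root (F : fieldType) (k : nat) (a : F) :
  GRing.closed_field_axiom F -> (0 < k)%N -> exists c : F, c ^+ k = a.
Proof.
case: k => // k closedF _.
have [c cE] := closedF k.+1 (fun i => if i == 0%N then a else 0) isT.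
by exists c; rewrite cE big_ord_recl /= mulr1 big1 ?addr0 // => i _; rewrite mul0r.
Qed.

(** With phi : L -> L_alpha an isomorphism, rescaling phi by an (n-1)-st root of
    alpha makes the constant alpha equal to 1; the multiplication of F is then
    transported to L. *)
Lemma Lalpha_iterated_mul (F : fieldType) (n : nat) (L : nalgebra F n) (alpha : F) :
  (2 <= n)%N -> GRing.closed_field_axiom F -> alpha != 0 ->
  isomorphic L (Lalpha n alpha) ->
  exists mul : L -> L -> L, isomorphic_to_base mul /\
    forall x : {ffun 'I_n -> L},
      bracket x = iterated_mul mul [seq x i | i <- enum 'I_n].
Proof.
case: n L => [|[|n]] // L _ closedF alpha_neq0 [phi [[psi phiK psiK] phiM]].
have [c cE] := closed_field_root alpha closedF (ltn0Sn n).
have c_neq0: c != 0.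
  by apply: contraNneq alpha_neq0 => c0; rewrite -cE c0 expr0n.
pose theta : 'Hom(L, F^o) := (c *: (phi : 'Hom(L, F^o)))%VF.
have thetaE v : theta v = c * (phi v : F) by rewrite scale_lfunE.
pose thetaV (a : F) : L := psi (c^-1 * a : F^o).
have thetaK : cancel theta thetaV by move=> v; rewrite /thetaV thetaE mulKf // phiK.
have thetaVK : cancel thetaV theta by move=> a; rewrite thetaE psiK mulVKf.
pose mul u v := thetaV ((theta u : F) * (theta v : F)).
have mulE u v : theta (mul u v) = (theta u : F) * (theta v : F) by rewrite thetaVK.
exists mul; split; first by exists theta; split=> //; exists thetaV.
move=> x; apply: (can_inj thetaK).
have foldE v s : theta (foldl mul v s) = (theta v : F) * \prod_(w <- s) (theta w : F).
  elim: s v => [|w s IHs] v /=; first by rewrite big_nil mulr1.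
  by rewrite IHs mulE big_cons mulrA.
have ->: theta (iterated_mul mul [seq x i | i <- enum 'I_n.+2]) =
    \prod_i (theta (x i) : F).
  rewrite enum_ordSl /= foldE big_map big_ord_recl big_map.
  by congr (_ * _); rewrite big_enum.
rewrite thetaE phiM /= /Lalpha_bracket (eq_bigr (fun i => phi (x i) : F)); last first.
  by move=> i _; rewrite ffunE.
rewrite -cE mulrA -exprS [RHS](eq_bigr (fun i => c * (phi (x i) : F)));
  last by move=> i _; exact: thetaE.
by rewrite big_split /= prodr_const card_ord.
Qed.

(** * The dimension of an anticommutative algebra *)

Lemma ltn_binomial m n : (2 <= n)%N -> (n.+2 <= m)%N -> (m < 'C(m, n))%N.
Proof.
elim: m n => // m IHm [|[|n]] // _.
rewrite ltnS leq_eqVlt => /orP[/eqP <- {m IHm}|lt_nm].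
  rewrite -bin_sub ?subSnn; last by rewrite !ltnS ltnW.
  rewrite (_ : (n.+4 - n.+2 = 2)%N); last by rewrite -[n.+4](addn2 n.+2) addKn.
  by rewrite bin2 /=; elim: n => // n IHn; lia.
by rewrite binS; have := IHm n.+2 isT lt_nm; have := bin_gt0 m n.+1; lia.
Qed.

Section Anticommutative.
Variables (F : fieldType) (n m : nat) (L : nalgebra F n) (e : m.-tuple L).
Hypothesis charF0 : [pchar F] =i pred0.
Hypothesis n_ge2 : (2 <= n)%N.
Hypothesis qder_full : forall f : 'End(L), QDerLL f.
Hypothesis be : basis_of fullv e.
Hypothesis anti : anticommutative_nalg L.

Lemma anticommutative_monomials :
  zero_product L \/
  forall c : 'I_n -> 'I_m, injective c -> monomial e c != 0.
Proof.
have [c /andP[/injectiveP c_inj /eqP c0] | nz] :=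
  pickP (fun c : {ffun 'I_n -> 'I_m} => injectiveb c && (monomial e c == 0)).
  left; apply: (monomial_eq0 charF0 qder_full be _ c0) => i p x /c_inj ->.
  by rewrite tperm1; congr bracket; apply/ffunP=> k; rewrite ffunE perm1.
right=> c c_inj; have := nz (finfun c); rewrite /monomial.
rewrite (_ : [ffun i => e`_(finfun c i)] = [ffun i => e`_(c i)]); last first.
  by apply/ffunP=> i; rewrite !ffunE.
case: injectiveP => [_ /negbT // | []].
by move=> i j; rewrite !ffunE => /c_inj.
Qed.

Lemma anticommutative_dim_lt : (m < n)%N -> zero_product L.
Proof.
move=> lt_mn x; apply: (multilinear_ext (h := fun=> 0) be).
- exact: bracket_multilinear.
- by move=> *; rewrite scaler0 addr0.
move=> g; have [/injectiveP g_inj | /injectivePn[i [j ij gij]]] :=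
  boolP (injectiveb g).
  by have := leq_card g g_inj; rewrite !card_ord leqNgt lt_mn.
by apply: (anticommutative_repeat charF0 anti ij); rewrite !ffunE gij.
Qed.

(** The monomials indexed by the n-subsets S of the basis have distinct weights,
    as the weight is the indicator function of S; hence binomial(m, n) <= m. *)
Lemma anticommutative_dim :
  (forall c : 'I_n -> 'I_m, injective c -> monomial e c != 0) ->
  (n <= m)%N -> m = n \/ m = n.+1.
Proof.
move=> c_neq0 le_nm.
(* Each n-subset is listed in increasing order by c. *)
pose K := {S : {set 'I_m} | #|S| == n}.
pose c (S : K) (i : 'I_n) : 'I_m := enum_val (cast_ord (esym (eqP (valP S))) i).
have c_inj S : injective (c S).
  by move=> i j /enum_val_inj/cast_ord_inj.
have c_weight S j : (weight (c S) j != 0%N) = (j \in val S).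
  rewrite -lt0n; apply/card_gt0P/idP => [[i] | jS].
    by rewrite inE => /eqP <-; apply: enum_valP.
  exists (cast_ord (eqP (valP S)) (enum_rank_in jS j)).
  by rewrite inE /c cast_ordK enum_rankK_in.
have: (#|{: K}| <= \dim {:L})%N.
  apply: card_free_family; apply: (monomials_free charF0 qder_full be (c := c)).
    by move=> S; apply: c_neq0.
  move=> S T ST; have [j jST | eqST] := pickP (fun j => (j \in val S) != (j \in val T)).
    by exists j; apply: contraNneq jST => w; rewrite -!c_weight w.
  case/eqP: ST; apply/val_inj/setP=> j; apply/eqP; exact: negbFE (eqST j).
rewrite card_sig (size_basis be) => leC.
have {leC}: ('C(m, n) <= m)%N.
  apply: leq_trans leC; rewrite -[m in 'C(m, _)]card_ord -card_draws.
  by apply/subset_leq_card/subsetP=> S; rewrite !inE.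
have [lt_nm | le_mn] := leqP n.+2 m; first by rewrite leqNgt ltn_binomial.
move: le_mn; rewrite ltnS leq_eqVlt => /orP[/eqP-> | lt_mn]; first by right.
by left; apply/eqP; rewrite eqn_leq le_nm -ltnS lt_mn.
Qed.

End Anticommutative.

(** * Anticommutative algebras of dimension n and n + 1 *)

(** Gaussian elimination writes the row c as a *: (first unit row) *m R with R
    invertible, so c is the first row of a *: R; a transposition of rows puts it
    at index i. *)
Lemma row_completion (F : fieldType) (n : nat) (c : 'rV[F]_n) (i : 'I_n) :
  c != 0 -> exists P : 'M[F]_n, P \in unitmx /\ row i P = c.
Proof.
case: n c i => [|n] c i c_neq0; first by case: i.
have := mulmx_ebase c; rewrite rank_rV c_neq0 (mx11_scalar (col_ebase c)).
set a := col_ebase c 0 0; set R := row_ebase c => cE.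
have a_neq0: a != 0.
  have := col_ebase_unit c.
  by rewrite unitmxE (mx11_scalar (col_ebase c)) det_scalar1 unitfE.
exists (xrow i 0 (a *: R)); split.
  by rewrite xrowE unitmx_mul unitmx_perm unitmxZ ?unitfE // row_ebase_unit.
rewrite -[RHS]cE mul_scalar_mx -scalemxAl (_ : pid_mx 1 = delta_mx 0 0 :> 'rV[F]_n.+1).
  by rewrite -rowE; apply/rowP=> j; rewrite !mxE tpermL.
by apply/rowP=> j; rewrite !mxE eq_sym; case: j => [[|j] jn].
Qed.

Section CoordRow.
Variables (F : fieldType) (V : vectType F) (m : nat) (e : m.-tuple V).

Definition coord_row (v : V) : 'rV[F]_m := \row_j coord e j v.

Fact coord_row_is_linear : linear coord_row.
Proof. by move=> a u v; apply/rowP=> j; rewrite !mxE linearP. Qed.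

HB.instance Definition _ :=
  GRing.isLinear.Build F V 'rV[F]_m *:%R coord_row coord_row_is_linear.

Hypothesis be : basis_of fullv e.

Lemma coord_rowK : cancel coord_row (fun r => \sum_j r 0 j *: e`_j).
Proof.
move=> v; rewrite [RHS](coord_basis_full v be).
by apply: eq_bigr => j _; rewrite mxE.
Qed.

Lemma coord_rowVK : cancel (fun r : 'rV[F]_m => \sum_j r 0 j *: e`_j) coord_row.
Proof.
by move=> r; apply/rowP=> j; rewrite mxE coord_sum_free ?(basis_free be).
Qed.

Lemma coord_row_basis (j : 'I_m) : coord_row e`_j = delta_mx 0 j.
Proof. by apply/rowP=> k; rewrite !mxE coord_basisE. Qed.

End CoordRow.

(** In the coordinates of e the product is x |-> det x *: u, with u nonzero. Right
    multiplication by N is an isomorphism onto A_n as soon as det N = 1 and N sends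
    u to the first unit vector. Completing u to a basis gives the second property;
    rescaling another coordinate then gives the first, which needs n >= 2. *)
Lemma isomorphic_A (F : fieldType) (n : nat) (L : nalgebra F n) (e : n.-tuple L) :
  [pchar F] =i pred0 -> (2 <= n)%N -> basis_of fullv e -> anticommutative_nalg L ->
  monomial e id != 0 -> isomorphic L (A_nalg F n).
Proof.
move=> F0 n_ge2 be anti u_neq0; set u := monomial e id in u_neq0.
pose i0 : 'I_n := Ordinal (ltnW n_ge2); pose i1 : 'I_n := Ordinal n_ge2.
have ru_neq0: coord_row e u != 0.
  apply: contraNneq u_neq0 => ru0; rewrite -(coord_rowK be u) ru0 big1 // => j _.
  by rewrite mxE scale0r.
have [P [Pu rowP0]] := row_completion i0 ru_neq0.
pose d : 'rV[F]_n := \row_j if j == i1 then \det P else 1.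
have dE : \prod_j d 0 j = \det P.
  by rewrite (bigD1 i1) //= big1 ?mulr1 => [|j /negbTE j1]; rewrite mxE ?eqxx ?j1.
pose N := invmx P *m diag_mx d.
have detN : \det N = 1.
  by rewrite det_mulmx det_inv det_diag dE mulVr // -unitmxE.
have Nu : N \in unitmx by rewrite unitmxE detN unitr1.
have uN : coord_row e u *m N = first_vec F n.
  rewrite -rowP0 rowE mulmxA mulmxK // mul_mx_diag; apply/rowP=> j.
  rewrite !mxE eqxx /=.
  have [->|] := eqVneq j i0; first by rewrite mul1r.
  by rewrite mul0r -val_eqE /= => /negbTE ->.
pose phi : 'Hom(L, A_nalg F n) := linfun (mulmxr N \o coord_row e : L -> 'rV[F]_n).
have phiE v : phi v = coord_row e v *m N by rewrite lfunE.
apply: (isomorphic_on_basis_anti F0 anti (@A_anticommutative F n) be (phi := phi)).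
  exists (fun r : 'rV[F]_n => \sum_j (r *m invmx N) 0 j *: e`_j) => [v | r].
    by rewrite phiE mulmxK // coord_rowK.
  by rewrite phiE (coord_rowVK be) mulmxKV.
move=> g g_inj; exists (perm g_inj)^-1%g.
rewrite (_ : [ffun i => _] = [ffun i : 'I_n => e`_i]); last first.
  by apply/ffunP=> i; rewrite !ffunE -[g _](permE g_inj) permKV.
rewrite /morph_at phiE -/u uN /= /A_bracket (_ : args_mx _ = N) ?detN ?scale1r //.
by apply/matrixP=> i j; rewrite mxE !ffunE phiE (coord_row_basis be) -rowE mxE.
Qed.

(** B is invertible because its columns are, up to sign, the coordinates of the
    monomials omitting one basis vector, which have distinct weights. *)
Lemma isomorphic_LB (F : fieldType) (n : nat) (L : nalgebra F n) (e : n.+1.-tuple L) :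
  [pchar F] =i pred0 -> basis_of fullv e -> anticommutative_nalg L ->
  (forall f : 'End(L), QDerLL f) ->
  (forall c : 'I_n -> 'I_n.+1, injective c -> monomial e c != 0) ->
  exists B : 'M[F]_n.+1, B \in unitmx /\ isomorphic L (LB B).
Proof.
move=> F0 be anti qder_full c_neq0.
pose v (i : 'I_n.+1) : L := (-1) ^+ (n + i.+1 + 1) *: monomial e (lift i).
pose B : 'M[F]_n.+1 := \matrix_(j, i) coord e j (v i); exists B; split.
  rewrite -unitmx_tr -row_free_unit; apply: inj_row_free => a aB0.
  have sum0: \sum_i a 0 i *: v i = 0.
    rewrite (coord_basis_full (\sum_i _) be) big1 // => j _.
    rewrite linear_sum; have := congr1 (fun r : 'rV_n.+1 => r 0 j) aB0.
    rewrite !mxE => aBj; rewrite (_ : \sum_i _ = 0) ?scale0r // -[RHS]aBj.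
    by apply: eq_bigr => i _; rewrite linearZ /= !mxE.
  apply/rowP=> i; rewrite [RHS]mxE; apply/eqP.
  have := monomials_free F0 qder_full be (c := fun i : 'I_n.+1 => lift i) _ _
    (a := fun i => a 0 i * (-1) ^+ (n + i.+1 + 1)) _ i.
  move=> /(_ _ _ _)/eqP; rewrite mulf_eq0 signr_eq0 orbF; apply.
  - by move=> k; apply/c_neq0/lift_inj.
  - move=> k l kl; exists k.
    have ->: weight (fun i => lift k i) k = 0%N.
      by apply: eq_card0 => j; rewrite inE eq_sym (negbTE (neq_lift _ _)).
    rewrite eq_sym -lt0n; apply/card_gt0P.
    have [j kE|klE] := unliftP l k; first by exists j; rewrite inE kE.
    by rewrite klE eqxx in kl.
  - by rewrite -[RHS]sum0; apply: eq_bigr => k _; rewrite scalerA.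
pose phi : 'Hom(L, LB B) := linfun (coord_row e : L -> 'rV[F]_n.+1).
have phiE w : phi w = coord_row e w by rewrite lfunE.
apply: (isomorphic_on_basis_anti F0 anti (@LB_anticommutative F n B) be (phi := phi)).
  exists (fun r : 'rV[F]_n.+1 => \sum_j r 0 j *: e`_j) => [w | r]; rewrite phiE.
    exact: coord_rowK.
  exact: coord_rowVK.
move=> g g_inj.
have [i gi]: exists i, i \notin codom g.
  apply/existsP; rewrite -negb_forall; apply/negP=> /forallP g_surj.
  have: (#|'I_n.+1| <= #|codom g|)%N.
    by apply/subset_leq_card/subsetP=> i _; apply: g_surj.
  by rewrite card_codom // !card_ord ltnn.
have [h gE]: exists h : 'I_n -> 'I_n, forall k, g k = lift i (h k).
  apply: (@fin_all_exists _ (fun=> 'I_n) (fun k j => g k = lift i j)) => k.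
  by have [j ->|gk] := unliftP i (g k); [exists j | rewrite -gk codom_f in gi].
have h_inj: injective h by move=> k l hkl; apply: g_inj; rewrite !gE hkl.
exists (perm h_inj)^-1%g.
rewrite (_ : [ffun i => _] = [ffun k : 'I_n => e`_(lift i k)]); last first.
  by apply/ffunP=> k; rewrite !ffunE gE -[h _](permE h_inj) permKV.
rewrite /morph_at phiE.
rewrite (_ : [ffun k => _] =
    [ffun k : 'I_n => delta_mx 0 (lift i k) : 'rV[F]_n.+1]); last first.
  by apply/ffunP=> k; rewrite !ffunE phiE (coord_row_basis be).
have signK : involutive (fun w : 'rV[F]_n.+1 => (-1) ^+ (n + i.+1 + 1) *: w).
  by move=> w; rewrite scalerA -expr2 sqrr_sign scale1r.
apply: (inv_inj signK).
rewrite LB_basisE -linearZ; apply/rowP=> j.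
rewrite mxE summxE (bigD1 j) //= big1 => [|k kj].
  by rewrite !mxE !eqxx mulr1 addr0.
by rewrite !mxE eq_sym (negbTE kj) andbF mulr0.
Qed.

(** * The vector product and the Filippov identity *)

Lemma eq_mx_mull (F : fieldType) (m n : nat) (A B : 'M[F]_(m, n)) :
  (forall u : 'rV_m, u *m A = u *m B) -> A = B.
Proof. by move=> AB; apply/row_matrixP=> i; rewrite !rowE AB. Qed.

Lemma eq_row_dot (F : fieldType) (n : nat) (u v : 'rV[F]_n) :
  (forall y : 'rV_n, u *m y^T = v *m y^T) -> u = v.
Proof.
move=> uv; apply: trmx_inj; apply: eq_mx_mull => y; apply: trmx_inj.
by rewrite !trmx_mul !trmxK uv.
Qed.

Lemma alternating_mx_skew (F : fieldType) (n : nat) (K : 'M[F]_n) :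
  (forall v : 'rV_n, v *m K *m v^T = 0) -> K^T = - K.
Proof.
move=> K0; have skew (u v : 'rV_n) : v *m K *m u^T = - (u *m K *m v^T).
  apply/eqP; rewrite -addr_eq0; apply/eqP; rewrite -[RHS](K0 (u + v)) linearD /=.
  by rewrite !mulmxDl !mulmxDr !K0 add0r addr0 addrC.
apply: eq_mx_mull => u; apply: eq_row_dot => v.
rewrite mulmxN mulNmx -skew [RHS]mx11_scalar -tr_scalar_mx -mx11_scalar.
by rewrite !trmx_mul trmxK mulmxA.
Qed.

Section ReplaceRow.
Variables (F : fieldType) (n : nat).

Definition replace_row (A : 'M[F]_n) (i : 'I_n) (r : 'rV[F]_n) : 'M[F]_n :=
  \matrix_(k, j) if k == i then r 0 j else A k j.

Lemma det_replace_row A i r : \det (replace_row A i r) = (r *m \adj A) 0 i.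
Proof.
rewrite (expand_det_row _ i) mxE; apply: eq_bigr => j _; rewrite !mxE eqxx.
congr (_ * (_ * \det _)); apply/matrixP=> k l.
by rewrite !mxE eq_sym (negbTE (neq_lift _ _)).
Qed.

(** The derivative of the determinant along D: the i-th summand is the i-th
    diagonal entry of A *m D *m \adj A, by Laplace expansion. *)
Lemma sum_det_replace_row (A D : 'M[F]_n) :
  \sum_i \det (replace_row A i (row i (A *m D))) = \tr D * \det A.
Proof.
rewrite -[RHS]mulrC -mxtraceZ -[\det A *: D]mul_scalar_mx -mul_adj_mx -mulmxA.
rewrite mxtrace_mulC; apply: eq_bigr => i _.
by rewrite det_replace_row rowE -mulmxA -rowE mxE.
Qed.

End ReplaceRow.

Section Cross.
Variables (F : fieldType) (n : nat).
Implicit Types (x y : {ffun 'I_n -> 'rV[F]_n.+1}) (z : 'rV[F]_n.+1).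

(** The generalised vector product of n vectors of F^(n+1); the sign makes z the
    last row in [cross_dot]. *)
Definition cross x : 'rV[F]_n.+1 :=
  \row_i ((-1) ^+ (n + i.+1 + 1) * \det (col' i (args_mx x))).

Definition rows_mx x z : 'M[F]_n.+1 :=
  \matrix_(i, j) if unlift ord_max i is Some k then x k 0 j else z 0 j.

Lemma row_rows_mx_max x z : row ord_max (rows_mx x z) = z.
Proof. by apply/rowP=> j; rewrite !mxE unlift_none. Qed.

Lemma row_rows_mx_lift x z k : row (lift ord_max k) (rows_mx x z) = x k.
Proof. by apply/rowP=> j; rewrite !mxE liftK. Qed.

Lemma rows_mxP (A B : 'M[F]_n.+1) : row ord_max A = row ord_max B ->
  (forall k : 'I_n, row (lift ord_max k) A = row (lift ord_max k) B) -> A = B.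
Proof.
by move=> AB_max AB; apply/row_matrixP=> i; case: (unliftP ord_max i) => [k|] ->.
Qed.

Lemma cross_dot x z : cross x *m z^T = (\det (rows_mx x z))%:M.
Proof.
rewrite [LHS]mx11_scalar; congr _%:M.
rewrite mxE (expand_det_row _ ord_max); apply: eq_bigr => j _.
rewrite !mxE unlift_none mulrC /cofactor; congr (_ * (_ * _));
  last apply: (congr1 (@determinant F n)).
  by rewrite addn1 addnS !exprS !mulN1r opprK.
by apply/matrixP=> k l; rewrite !mxE liftK.
Qed.

Lemma cross_multilinear : multilinear cross.
Proof.
move=> x k a u v; apply/rowP=> i; rewrite !mxE !col'_colsub.
by rewrite det_args_multilinear mulrDr mulrCA.
Qed.

Lemma LB_bracketE B x : @bracket F n (LB B) x = cross x *m B^T.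
Proof.
rewrite mulmx_sum_row /= /LB_bracket; apply: eq_bigr => i _.
rewrite mxE scalerA mulrC; congr (_ *: _).
apply/rowP=> j; rewrite !mxE summxE (bigD1 j) //= big1 => [|k kj].
  by rewrite !mxE !eqxx mulr1 addr0.
by rewrite !mxE eq_sym (negbTE kj) andbF mulr0.
Qed.

Lemma cross_delta (i : 'I_n.+1) :
  cross [ffun k : 'I_n => delta_mx 0 (lift i k) : 'rV[F]_n.+1] =
  (-1) ^+ (n + i.+1 + 1) *: delta_mx 0 i.
Proof. by rewrite -D_basisE LB_bracketE trmx1 mulmx1. Qed.

Lemma cross_mulmx x (M : 'M[F]_n.+1) :
  cross [ffun i => x i *m M] *m M^T = \det M *: cross x.
Proof.
apply: eq_row_dot => z; rewrite -mulmxA -trmx_mul -scalemxAl !cross_dot.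
rewrite scale_scalar_mx mulrC -det_mulmx; congr (\det _)%:M.
apply: rows_mxP => [|k]; rewrite row_mul.
  by rewrite !row_rows_mx_max.
by rewrite !row_rows_mx_lift ffunE.
Qed.

(** Pair both sides with z. If the matrix has rows x_1, ..., x_n, z, then replacing
    each row in turn by its image under D gives tr D times the determinant; the
    term for the row z is the one that D^T accounts for. *)
Lemma cross_derivation x (D : 'M[F]_n.+1) :
  \sum_i cross (subst_arg x i (x i *m D)) = cross x *m ((\tr D)%:M - D^T).
Proof.
apply: eq_row_dot => z; rewrite mulmxBr mulmxBl mul_mx_scalar -scalemxAl.
rewrite -[cross x *m D^T *m _]mulmxA -trmx_mul mulmx_suml !cross_dot scale_scalar_mx.
rewrite -sum_det_replace_row (bigD1_ord ord_max) //= -raddfB.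
rewrite (_ : replace_row _ ord_max _ = rows_mx x (z *m D)); last first.
  apply: rows_mxP => [|k].
    rewrite row_rows_mx_max; apply/rowP=> j.
    by rewrite mxE mxE eqxx row_mul row_rows_mx_max.
  rewrite row_rows_mx_lift -(row_rows_mx_lift x z); apply/rowP=> j.
  by rewrite !mxE eq_sym (negbTE (neq_lift _ _)).
rewrite [_ + _ - _]addrC addKr raddf_sum; apply: eq_bigr => i _; rewrite cross_dot /=.
congr (\det _)%:M; apply: rows_mxP => [|k].
  by apply/rowP=> j; rewrite !mxE unlift_none (negbTE (neq_lift _ _)).
rewrite row_rows_mx_lift ffunE; apply/rowP=> j; rewrite mxE.
rewrite [RHS]mxE (inj_eq lift_inj); have [_|_] := eqVneq k i.
  by rewrite row_mul row_rows_mx_lift.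
by rewrite !mxE liftK.
Qed.

End Cross.

Lemma filippov_isomorphic (F : fieldType) (n : nat) (L M : nalgebra F n) :
  isomorphic L M -> filippov L -> filippov M.
Proof.
move=> [f [[g fK gK] fM]] [anti jac].
have lift_args (x : {ffun 'I_n -> M}) : x = [ffun i => f ([ffun j => g (x j)] i)].
  by apply/ffunP=> i; rewrite !ffunE gK.
split=> [s x | i0 x y i0E].
  rewrite [x]lift_args; move: [ffun j => g (x j)] => {}x.
  rewrite -[X in _ = _ *: X]fM -linearZ -anti /= fM; congr bracket; apply/ffunP=> i.
  by rewrite !ffunE.
rewrite [x]lift_args [y]lift_args.
move: [ffun j => g (x j)] [ffun j => g (y j)] => {}x {}y.
rewrite -fM -subst_arg_comp -fM (jac _ _ _ i0E) linear_sum; apply: eq_bigr => i _.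
by rewrite ffunE -subst_arg_comp -fM -subst_arg_comp -fM.
Qed.

(** Suppose that B^T - B has a nonzero row c, and complete it to an invertible
    matrix P with rows c, y_2, ..., y_n, z. Let K be the skew matrix of
    v |-> cross (v, y_2, ..., y_n). The Filippov identity gives
    (B^T - B) *m K = t with t scalar; as K kills the nonzero vector y_2, t = 0,
    so c *m K = 0. But c *m K *m z^T = det P. *)
Lemma filippov_LB_symmetric (F : fieldType) (n : nat) (B : 'M[F]_n.+1) :
  (2 <= n)%N -> B \in unitmx -> filippov (LB B) -> B^T = B.
Proof.
move=> n_ge2 Bu [_ jac]; pose C := B^T - B.
pose i0 : 'I_n := Ordinal (ltnW n_ge2); pose i1 : 'I_n := Ordinal n_ge2.
apply/eqP; rewrite -subr_eq0 -/C; apply/eqP/row_matrixP=> i; rewrite row0.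
apply/eqP; apply: contraT => c_neq0.
have [P [Pu rowP]] := row_completion (lift ord_max i0) c_neq0.
pose y : {ffun 'I_n -> 'rV[F]_n.+1} := [ffun k => row (lift ord_max k) P].
pose K := \matrix_j cross (subst_arg y i0 (delta_mx 0 j)).
have KE v : v *m K = cross (subst_arg y i0 v).
  rewrite [v in RHS]row_sum_delta multilinear_sum; last exact: cross_multilinear.
  by rewrite mulmx_sum_row; apply: eq_bigr => j _; rewrite rowK.
have K_skew : K^T = - K.
  apply: alternating_mx_skew => v; rewrite KE cross_dot.
  rewrite (determinant_alternate (neq_lift ord_max i0)) ?raddf0 // => j.
  by rewrite !mxE unlift_none liftK ffunE eqxx.
have K_y1 : K *m (y i1)^T = 0.
  apply: eq_mx_mull => v; rewrite mulmx0 mulmxA KE cross_dot.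
  rewrite (determinant_alternate (neq_lift ord_max i1)) ?raddf0 // => j.
  by rewrite !mxE unlift_none liftK !ffunE !mxE.
pose t := \tr (K *m B^T).
have CK : C *m K = t%:M.
  (* Compare the two sides of the Filippov identity on all x: the vectors cross x
     contain the unit vectors up to sign. *)
  have E : B^T *m K *m B^T = (t%:M - (K *m B^T)^T) *m B^T.
    apply: eq_mx_mull => u; rewrite [u]row_sum_delta !mulmx_suml; apply: eq_bigr => j _.
    rewrite -!scalemxAl; congr (_ *: _).
    have := jac i0 [ffun k : 'I_n => delta_mx 0 (lift j k) : 'rV[F]_n.+1] y erefl.
    move: [ffun k => _] (cross_delta F j) => x xE.
    rewrite !LB_bracketE -KE.
    rewrite (eq_bigr
      (fun k => cross (subst_arg x k (x k *m (K *m B^T))) *m B^T)); last first.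
      by move=> k _; rewrite !LB_bracketE -KE mulmxA.
    rewrite -mulmx_suml cross_derivation xE -!scalemxAl.
    move/(congr1 (fun v => (-1) ^+ (n + j.+1 + 1) *: v)).
    by rewrite !scalerA -expr2 sqrr_sign !scale1r !mulmxA.
  have := congr1 (mulmxr (invmx B^T)) E.
  rewrite /= !mulmxK ?unitmx_tr // /C mulmxBl => ->.
  by rewrite trmx_mul trmxK K_skew mulmxN opprK addrK.
have y1_neq0 : y i1 != 0.
  apply/eqP=> y0; have := congr1 (mulmxr (invmx P)) y0.
  rewrite /= ffunE rowE mulmxK // mul0mx => /matrixP/(_ 0 (lift ord_max i1))/eqP.
  by rewrite !mxE !eqxx oner_eq0.
have t0 : t = 0.
  apply/eqP; have /eqP := congr1 (mulmx C) K_y1.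
  by rewrite mulmxA CK mulmx0 mul_scalar_mx scaler_eq0 trmx_eq0 (negbTE y1_neq0) orbF.
have := cross_dot (subst_arg y i0 (row i C)) (row ord_max P).
rewrite -KE -row_mul CK t0 raddf0 row0 mul0mx (_ : rows_mx _ _ = P).
  move=> /matrixP/(_ 0 0)/esym/eqP; rewrite !mxE mulr1n.
  by move: Pu; rewrite unitmxE unitfE => /negbTE ->.
apply: rows_mxP => [|k]; first by rewrite row_rows_mx_max.
by rewrite row_rows_mx_lift ffunE; case: eqP => [-> //|_]; rewrite ffunE.
Qed.

(** * Symmetric matrices over an algebraically closed field *)

Lemma delta_dot (F : fieldType) (m n : nat) (A : 'M[F]_(m, n)) i j :
  ((delta_mx 0 i : 'rV[F]_m) *m A *m (delta_mx 0 j : 'rV[F]_n)^T) 0 0 = A i j.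
Proof. by rewrite -rowE trmx_delta -colE !mxE. Qed.

(** By polarization it is enough to look at the sums of two unit vectors. *)
Lemma exists_anisotropic (F : fieldType) (n : nat) (B : 'M[F]_n) :
  [pchar F] =i pred0 -> B^T = B -> B != 0 ->
  exists x : 'rV_n, (x *m B *m x^T) 0 0 != 0.
Proof.
move=> /pcharf0P F0 Bsym B_neq0.
pose d (i : 'I_n) : 'rV[F]_n := delta_mx 0 i.
have dot i j := delta_dot B i j.
pose x i j := d i + d j.
have [[i j] /= q_neq0 | q0] :=
  pickP (fun p => (x p.1 p.2 *m B *m (x p.1 p.2)^T) 0 0 != 0); first by exists (x i j).
have qE i j : B i i + B i j + (B j i + B j j) = 0.
  have := q0 (i, j) => /negbFE/eqP.
  rewrite /= /x !mulmxDl [(d i + d j)^T]linearD !mulmxDr.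
  by rewrite mxE [X in X + _ = _]mxE [X in _ + X = _]mxE !dot.
have B0 i : B i i = 0.
  have /eqP := qE i i; rewrite -mulr2n -mulr2n -mulrnA -mulr_natl mulf_eq0 F0.
  by move/eqP.
case/eqP: B_neq0; apply/matrixP=> i j; rewrite mxE.
have Bij : B i j = B j i by rewrite -{1}Bsym mxE.
have /eqP := qE i j; rewrite !B0 add0r addr0 -Bij -mulr2n -mulr_natl mulf_eq0 F0.
by move/eqP.
Qed.

(** Diagonalisation by induction on n: complete a vector x with
    x *m B *m x^T = 1, which exists after rescaling by a square root, to a
    basis, and clear the rest of the first row and column. *)
Lemma symmetric_congruent_one (F : fieldType) (n : nat) (B : 'M[F]_n) :
  [pchar F] =i pred0 -> GRing.closed_field_axiom F -> B^T = B -> B \in unitmx ->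
  exists T : 'M[F]_n, T *m B *m T^T = 1%:M.
Proof.
move=> F0 closedF; elim: n B => [|n IHn] B Bsym Bu.
  by exists 1%:M; apply/matrixP=> [[]].
have B_neq0: B != 0 by apply: contraTneq Bu => ->; rewrite unitmxE det0 unitr0.
have [x q_neq0] := exists_anisotropic F0 Bsym B_neq0.
have [c cE] := closed_field_root ((x *m B *m x^T) 0 0)^-1 closedF (ltn0Sn 1).
have x_neq0: c *: x != 0.
  rewrite scaler_eq0 negb_or; apply/andP; split.
    apply: contraTneq q_neq0 => c0; move/eqP: cE.
    by rewrite c0 expr0n eq_sym invr_eq0 => ->.
  by apply: contraNneq q_neq0 => ->; rewrite !mul0mx mxE.
have [P [Pu rowP]] := row_completion (0 : 'I_(1 + n)) x_neq0.
pose B' : 'M[F]_(1 + n) := P *m B *m P^T.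
have B'sym : B'^T = B' by rewrite /B' !trmx_mul trmxK Bsym mulmxA.
have B'u : B' \in unitmx by rewrite !unitmx_mul unitmx_tr Pu Bu.
have B'00 : ulsubmx B' = 1%:M.
  rewrite [LHS]mx11_scalar; congr _%:M; rewrite mxE mxE.
  have -> : B' (lshift n 0) (lshift n 0) = (row 0 P *m B *m (row 0 P)^T) 0 0.
    rewrite rowE trmx_mul
      (_ : _ *m _ = delta_mx 0 0 *m B' *m (delta_mx 0 0)^T).
      by rewrite delta_dot; congr (B' _ _); apply/val_inj.
    by rewrite /B' !mulmxA.
  rewrite rowP linearZ /= -!scalemxAl -scalemxAr scalerA mxE -expr2 cE.
  by rewrite mulVf.
pose b := ursubmx B'; pose D := drsubmx B'.
have B'E : B' = block_mx 1%:M b b^T D.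
  by rewrite -[LHS]submxK B'00 /b trmx_ursub B'sym.
pose E : 'M[F]_(1 + n) := block_mx 1%:M 0 (- b^T) 1%:M.
pose C := D - b^T *m b.
have EBE : E *m B' *m E^T = block_mx 1%:M 0 0 C.
  rewrite B'E /E tr_block_mx !trmx1 trmx0 linearN /= trmxK !mulmx_block.
  rewrite !(mul1mx, mulmx1, mul0mx, mulmx0, addr0, add0r, mulmxN, mulNmx).
  by rewrite !(addNr, oppr0, mul0mx, addr0, add0r, subrr) /C addrC.
have Eu : E \in unitmx by rewrite unitmxE det_lblock !det1 mulr1 unitr1.
have Csym : C^T = C.
  by rewrite /C linearB /= trmx_mul trmxK /D trmx_drsub B'sym.
have Cu : C \in unitmx.
  have: E *m B' *m E^T \in unitmx by rewrite 2!unitmx_mul unitmx_tr Eu B'u.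
  by rewrite EBE !unitmxE det_ublock det1 mul1r.
have [T TE] := IHn C Csym Cu.
exists (block_mx 1%:M 0 0 T *m E *m P : 'M_(1 + n)).
have -> (S : 'M[F]_(1 + n)) : S *m E *m P *m B *m (S *m E *m P)^T =
    S *m (E *m B' *m E^T) *m S^T.
  by rewrite /B' !trmx_mul !mulmxA.
rewrite EBE tr_block_mx !mulmx_block !trmx0 trmx1.
rewrite !(mul1mx, mulmx1, mul0mx, mulmx0, addr0, add0r) TE.
by rewrite -scalar_mx_block.
Qed.

(** * Isomorphism of L_B with D_(n+1) *)

Lemma isomorphic_trans (F : fieldType) (n : nat) (L M N : nalgebra F n) :
  isomorphic L M -> isomorphic M N -> isomorphic L N.
Proof.
move=> [f [f_bij fM]] [g [g_bij gM]]; exists (g \o f)%VF; split.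
  by apply: (eq_bij (bij_comp g_bij f_bij)) => v; rewrite comp_lfunE.
move=> x; rewrite comp_lfunE fM gM; congr bracket.
by apply/ffunP=> i; rewrite !ffunE comp_lfunE.
Qed.

Lemma LB_isomorphic_D (F : fieldType) (n : nat) (B M : 'M[F]_n.+1) :
  M \in unitmx -> M^T *m B^T *m M = (\det M)%:M -> isomorphic (LB B) (D_nalg F n).
Proof.
move=> Mu MBM; have Mtu : M^T \in unitmx by rewrite unitmx_tr.
(* M^T is invertible, so it may be moved to the other side of a scalar product. *)
have BMM : B^T *m M *m M^T = (\det M)%:M.
  apply: (can_inj (mulKmx Mtu)); rewrite !mulmxA MBM.
  by rewrite mul_scalar_mx mul_mx_scalar.
pose phi : 'Hom(LB B, D_nalg F n) := linfun (mulmxr M : 'rV[F]_n.+1 -> 'rV[F]_n.+1).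
have phiE v : phi v = v *m M by rewrite lfunE.
exists phi; split.
  by exists (mulmxr (invmx M)) => v; rewrite ?phiE /= ?mulmxK ?phiE ?mulmxKV.
move=> x; rewrite phiE !LB_bracketE trmx1 mulmx1.
rewrite (_ : [ffun i => phi (x i)] = [ffun i => x i *m M]); last first.
  by apply/ffunP=> i; rewrite !ffunE phiE.
apply: (can_inj (mulmxK Mtu)).
by rewrite cross_mulmx -mul_mx_scalar -BMM !mulmxA.
Qed.

(** For M = c *: T^T with T *m B *m T^T = 1, the condition
    M^T *m B^T *m M = det M reads c^2 = c^(n+1) * det T, solvable for c as
    n >= 2. *)
Lemma filippov_LB_isomorphic_D (F : fieldType) (n : nat) (B : 'M[F]_n.+1) :
  [pchar F] =i pred0 -> GRing.closed_field_axiom F -> (2 <= n)%N ->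
  B \in unitmx -> filippov (LB B) -> isomorphic (LB B) (D_nalg F n).
Proof.
move=> F0 closedF n_ge2 Bu jac; have Bsym := filippov_LB_symmetric n_ge2 Bu jac.
have [T TBT] := symmetric_congruent_one F0 closedF Bsym Bu.
have Tu : T \in unitmx by have := mulmx1_unit (etrans (mulmxA _ _ _) TBT) => -[].
have dT_neq0 : \det T != 0 by move: Tu; rewrite unitmxE unitfE.
case: n n_ge2 => [|n] n_ge2 in B Bu jac Bsym T TBT Tu dT_neq0 *; first by [].
have [c cE] := closed_field_root (\det T)^-1 closedF n_ge2.
have c_neq0 : c != 0.
  apply: contraNneq dT_neq0 => c0; move/eqP: cE.
  by rewrite c0 expr0n gtn_eqF //= eq_sym invr_eq0.
apply: (@LB_isomorphic_D _ _ B (c *: T^T)).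
  by rewrite unitmxZ ?unitfE // unitmx_tr.
rewrite [(c *: T^T)^T]linearZ /= trmxK Bsym -!scalemxAl -scalemxAr scalerA TBT.
rewrite detZ det_tr.
by rewrite !exprS cE -!mulrA mulVf // mulr1 scalemx1.
Qed.

(** * The classification *)

Section Classification.
Variables (F : fieldType) (n : nat) (L : nalgebra F n).
Hypothesis charF0 : [pchar F] =i pred0.
Hypothesis n_ge2 : (2 <= n)%N.
Hypothesis qder_full : forall f : 'End(L), QDerLL f.

Lemma commutative_classification : commutative_nalg L ->
  zero_product L \/ exists alpha : F, isomorphic L (Lalpha n alpha).
Proof.
move=> comm; move: (vbasisP (fullv : {vspace L})).
move: (vbasis _); move: (\dim _) => [|[|m]] e be.
- by left; apply: dim0_zero_product be.
- by right; apply: dim1_isomorphic be.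
- by left; apply: commutative_dim_ge2 be comm _.
Qed.

Lemma anticommutative_classification : anticommutative_nalg L ->
  zero_product L \/ isomorphic L (A_nalg F n) \/
  exists B : 'M[F]_n.+1, B \in unitmx /\ isomorphic L (LB B).
Proof.
move=> anti; move: (vbasisP (fullv : {vspace L})).
move: (vbasis _); move: (\dim _) => m e be.
have [? | c_neq0] := anticommutative_monomials charF0 qder_full be; first by left.
have [lt_mn | le_nm] := ltnP m n.
  by left; apply: (anticommutative_dim_lt charF0 be anti).
right; have := anticommutative_dim charF0 n_ge2 qder_full be c_neq0 le_nm.
case=> mE; subst m; [left | right; exact: (isomorphic_LB charF0 be)].
by apply: (isomorphic_A charF0 n_ge2 be anti); apply: c_neq0 => i j.
Qed.

End Classification.

Theorem theorem4p6 (F : fieldType) (n : nat) (L : nalgebra F n)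
    (charF0 : [pchar F] =i pred0) (n_ge2 : (2 <= n)%N)
    (qder_full : forall f : 'End(L), QDerLL f) :
  (commutative_nalg L ->
     (zero_product L \/ exists alpha : F, isomorphic L (Lalpha n alpha)) /\
     (GRing.closed_field_axiom F -> ~ zero_product L ->
        exists mul : L -> L -> L,
          isomorphic_to_base mul /\
          forall x : {ffun 'I_n -> L},
            bracket x = iterated_mul mul [seq x i | i <- enum 'I_n]))
  /\
  (anticommutative_nalg L ->
     (zero_product L \/
      isomorphic L (A_nalg F n) \/
      exists B : 'M[F]_n.+1, B \in unitmx /\ isomorphic L (LB B)) /\
     ((exists B : 'M[F]_n.+1, B \in unitmx /\ isomorphic L (LB B)) ->
        filippov L -> GRing.closed_field_axiom F ->
        isomorphic L (D_nalg F n))).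
Proof.
split=> [comm | anti]; split.
- exact: commutative_classification.
- move=> closedF nz.
  have [//|[alpha iso]] := commutative_classification charF0 n_ge2 qder_full comm.
  apply: (Lalpha_iterated_mul n_ge2 closedF _ iso).
  apply/eqP=> alpha0; apply: nz => x; have [phi [phi_bij phiM]] := iso.
  by apply: (bij_inj phi_bij); rewrite phiM linear0 /= /Lalpha_bracket alpha0 mul0r.
- exact: anticommutative_classification.
- case=> B [Bu iso] jac closedF; apply: (isomorphic_trans iso).
  by apply: filippov_LB_isomorphic_D => //; apply: (filippov_isomorphic iso jac).
Qed.
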